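(* Let $A:\mathbb{R}^n\to\mathbb{R}^m$ be linear, let $f:\mathbb{R}^n\to\mathbb{R}\cup\{\infty\}$ be proper, closed and strongly convex with modulus $\mu_f>0$, let $g:\mathbb{R}^m\to\mathbb{R}\cup\{\infty\}$ be proper, closed and convex, with $A\,\mathrm{dom}\, f\cap\mathrm{dom}\, g\neq\emptyset$, and let $\gamma>0$. Let $(x_\star,y_\star)$ be a primal-dual solution, i.e. $-A^\top y_\star\in\partial f(x_\star)$ and $y_\star\in\partial g(Ax_\star)$. Suppose that $f$ is strictly twice epi-differentiable at all $x\in\mathrm{dom}\, f$ close enough to $x_\star$, and that the second-order epi-derivative of $f$ at $x_\star$ for $-A^\top y_\star$ is $w\mapsto\langle H_fw,w\rangle+\delta_{S_f}(w)$, where $S_f\subseteq\mathbb{R}^n$ is a linear subspace and $H_f\in\mathbb{R}^{n\times n}$ is symmetric positive semidefinite with $\mathrm{range}(H_f)=S_f$ and $\ker(H_f)=S_f^\perp$. Then $\psi_\gamma$ is of class $C^1$ around $y_\star$, with $$\nabla\psi_\gamma(y)=Q_\gamma(y)R_\gamma(y),\qquad Q_\gamma(y)=I-\gamma A\nabla^2f^*(-A^\top y)A^\top .$$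
   Context: $A^\top$ is the adjoint; $h^*$ the Fenchel conjugate; $\delta_S$ is the indicator function of $S$ ($0$ on $S$, $\infty$ elsewhere); strong convexity of $f$ with modulus $\mu_f$ means $f-\frac{\mu_f}{2}\|\cdot\|^2$ is convex. The augmented Lagrangian is $\mathcal{L}_\gamma(x,z,y)=f(x)+g(z)+\langle y,Ax-z\rangle+\frac{\gamma}{2}\|Ax-z\|^2$. Define $x(y)=\arg\min_x\{f(x)+\langle y,Ax\rangle\}=\nabla f^*(-A^\top y)$, $z_\gamma(y)=\arg\min_z\mathcal{L}_\gamma(x(y),z,y)$, $\psi_\gamma(y)=-\mathcal{L}_\gamma(x(y),z_\gamma(y),y)$, and $R_\gamma(y)=z_\gamma(y)-Ax(y)$. Twice epi-differentiability: $h:\mathbb{R}^n\to\mathbb{R}\cup\{\infty\}$ is twice epi-differentiable at $x$ for $v$ if the second-order difference quotients $d\mapsto\frac{h(x+\tau d)-h(x)-\tau\langle v,d\rangle}{\tau^2/2}$ epi-converge (epigraphs converge in the Painlevé–Kuratowski sense) as $\tau\searrow0$; the limit function of $d$ is the second-order epi-derivative of $h$ at $x$ for $v$. It is strictly twice epi-differentiable at $x$ for $v$ if the quotients $d\mapsto\frac{h(\bar x+\tau d)-h(\bar x)-\tau\langle\bar v,d\rangle}{\tau^2/2}$ epi-converge as $\tau\searrow0$, $\bar x\to x$, $\bar v\to v$ (with $\bar v\in\partial h(\bar x)$). ''Strictly twice epi-differentiable at $x$'' means for every $v\in\partial f(x)$. *)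

(* Defs.v *)
From HB Require Import structures.
From mathcomp Require Export all_boot all_order all_algebra.
From mathcomp Require Export all_classical all_reals all_analysis.
Export Order.TTheory GRing.Theory Num.Theory.
Export numFieldNormedType.Exports.
Set Implicit Arguments.
Unset Strict Implicit.
Unset Printing Implicit Defensive.
#[export] Set Implicit Arguments.
#[export] Unset Strict Implicit.
#[export] Unset Printing Implicit Defensive.

#[global] Open Scope classical_set_scope.
#[global] Open Scope ring_scope.

(* The library norm on 'cV[R]_n is the sup norm, so Euclidean quantities are
   written with the dot product; the topology is the same. *)
Definition dot {R : realType} {n : nat} (u v : 'cV[R]_n) : R :=
  \sum_i u i 0 * v i 0.

Section ConvexAnalysis.
Context {R : realType} {n : nat}.
Implicit Types (h : 'cV[R]_n -> \bar R) (x v w : 'cV[R]_n).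

Definition edom h : set 'cV[R]_n := [set x | (h x < +oo)%E].

Definition proper h : Prop := (forall x, h x != -oo%E) /\ edom h !=set0.

Definition epigraph h : set ('cV[R]_n * R) := [set p | (h p.1 <= p.2%:E)%E].

Definition closed_fun h : Prop := closed (epigraph h).

(* Meant for functions that avoid -oo, so that no +oo - oo occurs. *)
Definition convex_efun h : Prop :=
  forall x w (t : R), 0 < t -> t < 1 ->
    (h (t *: x + (1 - t) *: w)%R <= t%:E * h x + (1 - t)%:E * h w)%E.

Definition strongly_convex (mu : R) h : Prop :=
  convex_efun (fun x => h x - (mu / 2 * dot x x)%:E)%E.

Definition subdiff h x : set 'cV[R]_n :=
  [set v | h x \is a fin_num /\
           forall w, (h x + (dot v (w - x)%R)%:E <= h w)%E].

Definition fenchel h : 'cV[R]_n -> \bar R :=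
  fun v => ereal_sup (range (fun x => (dot v x)%:E - h x)%E).

(* Some minimizer of h if there is one, and 0 otherwise. *)
Definition argmin h : 'cV[R]_n :=
  get [set x | forall w, (h x <= h w)%E].

Definition indic_fun (S : set 'cV[R]_n) : 'cV[R]_n -> \bar R :=
  fun w => if w \in S then 0%E else +oo%E.

End ConvexAnalysis.

(* Painleve-Kuratowski convergence of a family of sets along a filter. *)
Section SetConvergence.
Context {I : Type} {T : topologicalType}.

Definition inner_limit (F : set_system I) (C : I -> set T) : set T :=
  [set p | forall V, nbhs p V -> \forall i \near F, C i `&` V !=set0].

Definition outer_limit (F : set_system I) (C : I -> set T) : set T :=
  [set p | forall V W, nbhs p V -> F W ->
             exists2 i, W i & C i `&` V !=set0].

Definition pk_cvg (F : set_system I) (C : I -> set T) (L : set T) : Prop :=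
  inner_limit F C = L /\ outer_limit F C = L.

End SetConvergence.

Section SecondOrder.
Context {R : realType} {n : nat}.
Implicit Types (h : 'cV[R]_n -> \bar R) (x v : 'cV[R]_n).

Definition epi_cvg (I : Type) (F : set_system I)
    (phi : I -> 'cV[R]_n -> \bar R) (l : 'cV[R]_n -> \bar R) : Prop :=
  pk_cvg F (fun i => epigraph (phi i)) (epigraph l).

Definition quot2 h (tau : R) x v : 'cV[R]_n -> \bar R := fun d =>
  ((h (x + tau *: d)%R - h x - (tau * dot v d)%:E) * ((tau ^+ 2 / 2)^-1)%:E)%E.

Definition is_epi_derivative2 h x v (l : 'cV[R]_n -> \bar R) : Prop :=
  epi_cvg 0^'+ (fun tau => quot2 h tau x v) l.

(* The triple ((tau, x'), v') tends to ((0+, x), v) with v' a subgradient at x'. *)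
Definition strict_filter h x v : set_system (R * 'cV[R]_n * 'cV[R]_n) :=
  within [set p | subdiff h p.1.2 p.2]
    (filter_prod (filter_prod (0 : R)^'+ (nbhs x)) (nbhs v)).

Definition strictly_twice_epi_differentiable_for h x v : Prop :=
  exists l : 'cV[R]_n -> \bar R,
    epi_cvg (strict_filter h x v) (fun p => quot2 h p.1.1 p.1.2 p.2) l.

Definition strictly_twice_epi_differentiable h x : Prop :=
  forall v, subdiff h x v -> strictly_twice_epi_differentiable_for h x v.

End SecondOrder.

(* Smoothness of extended-real-valued functions that are finite near a point. *)
Section Smoothness.
Context {R : realType} {n : nat}.
Implicit Types (h : 'cV[R]_n -> \bar R) (x : 'cV[R]_n).

Definition ediff h x : Prop :=
  (\forall z \near x, h z \is a fin_num) /\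
  differentiable (fine \o h : 'cV[R]_n -> R^o) x.

Definition grad h x : 'cV[R]_n :=
  \col_i 'D_(delta_mx i 0) (fine \o h : 'cV[R]_n -> R^o) x.

Definition hess h x : 'M[R]_n :=
  \matrix_(i, j) ('D_(delta_mx j 0) (grad h) x) i 0.

Definition twice_ediff h x : Prop :=
  (\forall z \near x, ediff h z) /\ differentiable (grad h) x.

Definition C1_around h x : Prop :=
  \forall z \near x, ediff h z /\ {for z, continuous (grad h)}.

End Smoothness.

Section AugmentedLagrangian.
Context {R : realType} {n m : nat}.
Variables (A : 'M[R]_(m, n)) (f : 'cV[R]_n -> \bar R) (g : 'cV[R]_m -> \bar R).
Variable gamma : R.
Implicit Types (x : 'cV[R]_n) (z y : 'cV[R]_m).

Definition aug_lagrangian x z y : \bar R :=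
  (f x + g z + (dot y (A *m x - z)%R)%:E
   + (gamma / 2 * dot (A *m x - z)%R (A *m x - z)%R)%:E)%E.

Definition x_of y : 'cV[R]_n :=
  argmin (fun x => f x + (dot y (A *m x)%R)%:E)%E.

Definition z_of y : 'cV[R]_m :=
  argmin (fun z => aug_lagrangian (x_of y) z y).

Definition psi y : \bar R := (- aug_lagrangian (x_of y) (z_of y) y)%E.

Definition Rmap y : 'cV[R]_m := z_of y - A *m x_of y.

Definition Qmap y : 'M[R]_m :=
  1%:M - gamma *: (A *m hess (fenchel f) (- (A^T *m y)) *m A^T).

End AugmentedLagrangian.

(* Main.v *)
Require Import Defs.
From HB Require Import structures.
From mathcomp Require Import ring lra.

(** With [v = - A^T y] and [a y = A (grad f^* v)], completing the square gives
    [psi y = f^* v + k^* (y + gamma a y) - gamma / 2 |a y|^2], where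
    [k = g + gamma / 2 |.|^2] is strongly convex like [f]; both conjugates have
    Lipschitz gradients.  The only delicate point is that [f^*] is C^2 near
    [- A^T ys].  The difference quotients of [f^*] are the conjugates of those
    of [f], so their values converge when the latter epi-converge.  Polarizing
    the limit shows that every directional quotient of [grad f^*] in a
    coordinate direction converges, uniformly in the base point, i.e. that
    [grad f^*] has strict partial derivatives, with a symmetric Jacobian.
    Strict differentiability at all points near [- A^T ys] makes [f^*] of
    class C^2 there. *)

(** * Dot product and Frechet differentiability *)

Section DotProduct.
Context {R : realType} {n : nat}.
Implicit Types (u v w : 'cV[R]_n) (c : R).

Lemma dotC u v : dot u v = dot v u.
Proof. by apply: eq_bigr => i _; rewrite mulrC. Qed.

Lemma dotDr u v w : dot u (v + w) = dot u v + dot u w.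
Proof. by rewrite /dot -big_split; apply: eq_bigr => i _ /=; rewrite mxE mulrDr. Qed.

Lemma dotZr c u v : dot u (c *: v) = c * dot u v.
Proof. by rewrite /dot mulr_sumr; apply: eq_bigr => i _; rewrite mxE mulrCA. Qed.

Lemma dotNr u v : dot u (- v) = - dot u v.
Proof. by rewrite -scaleN1r dotZr mulN1r. Qed.

Lemma dotDl u v w : dot (v + w) u = dot v u + dot w u.
Proof. by rewrite dotC dotDr !(dotC u). Qed.

Lemma dotZl c u v : dot (c *: v) u = c * dot v u.
Proof. by rewrite dotC dotZr (dotC u). Qed.

Lemma dotNl u v : dot (- v) u = - dot v u.
Proof. by rewrite dotC dotNr (dotC u). Qed.

Lemma dotr0 u : dot u 0 = 0.
Proof. by rewrite -(scale0r u) dotZr mul0r. Qed.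

Lemma dot0r u : dot 0 u = 0.
Proof. by rewrite dotC dotr0. Qed.

Definition dotE := (dotDr, dotDl, dotNr, dotNl, dotZr, dotZl, dotr0, dot0r).

Lemma dot_delta u i : dot (delta_mx i 0) u = u i 0.
Proof.
rewrite /dot (bigD1 i) //= mxE !eqxx mul1r big1 ?addr0 // => j /negbTE ji.
by rewrite mxE ji mul0r.
Qed.

Lemma dot_ge0 u : 0 <= dot u u.
Proof. by apply: sumr_ge0 => i _; rewrite -expr2 sqr_ge0. Qed.

End DotProduct.

(** * Sup norm against dot product, and compact boxes *)

Section NormBounds.
Context {R : realType}.

Lemma lip_continuous (V W : normedModType R) (f : V -> W) (C : R) :
  (forall u w, `|f u - f w| <= C * `|u - w|) -> continuous f.
Proof.
move=> fC u; apply/cvgrPdist_le => e e0; near=> w.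
(* [C] may be zero or negative, so the positive constant [|C| + 1] is used to divide. *)
apply: (le_trans (fC _ _)); apply: (@le_trans _ _ ((`|C| + 1) * `|u - w|)).
  by rewrite ler_wpM2r // (le_trans (ler_norm C)) // lerDl.
rewrite -ler_pdivlMl ?ltr_wpDl //; near: w.
by apply: cvgr_dist_le; [exact: cvg_id|rewrite mulr_gt0 // invr_gt0 ltr_wpDl].
Unshelve. all: by end_near. Qed.

Lemma cV_norm_coord n (u : 'cV[R]_n) i : `|u i 0| <= `|u|.
Proof.
rewrite [leRHS]/Num.norm /= mx_normrE; apply/bigmax_geP; right => /=.
by exists (i, 0).
Qed.

Lemma cV_norm_le n (u : 'cV[R]_n) (c : R) :
  0 <= c -> (forall i, `|u i 0| <= c) -> `|u| <= c.
Proof.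
move=> c0 uc; rewrite [leLHS]/Num.norm /= mx_normrE; apply/bigmax_leP; split => //.
by case=> i j _ /=; rewrite ord1; exact: uc.
Qed.

(** Cauchy-Schwarz for the sup norm: each of the [n] coordinate products is at most the product of
    the norms, whence the factor [n] here and in later Lipschitz constants. *)
Lemma dot_norm_le n (u v : 'cV[R]_n) : `|dot u v| <= n%:R * (`|u| * `|v|).
Proof.
apply: (le_trans (ler_norm_sum _ _ _)).
have -> : n%:R * (`|u| * `|v|) = \sum_(i < n) (`|u| * `|v|).
  by rewrite sumr_const card_ord mulr_natl.
by apply: ler_sum => i _; rewrite normrM ler_pM // cV_norm_coord.
Qed.

Lemma dot_le_norm n (u v : 'cV[R]_n) : dot u v <= n%:R * (`|u| * `|v|).
Proof. exact: le_trans (ler_norm _) (dot_norm_le _ _). Qed.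

Lemma norm_sq_le_dot n (u : 'cV[R]_n) : `|u| ^+ 2 <= dot u u.
Proof.
rewrite -[leRHS]sqr_sqrtr ?dot_ge0 // ler_sqr ?nnegrE ?sqrtr_ge0 //.
apply: cV_norm_le => [|i]; first exact: sqrtr_ge0.
rewrite -sqrtr_sqr ler_wsqrtr // /dot (bigD1 i) //= expr2 lerDl.
by apply: sumr_ge0 => j _; rewrite -expr2 sqr_ge0.
Qed.

Lemma mulmx_norm_le p n (M : 'M[R]_(p, n)) :
  exists2 C, 0 < C & forall u : 'cV[R]_n, `|M *m u| <= C * `|u|.
Proof.
exists (n%:R * `|M| + 1) => [|u]; first by rewrite ltr_wpDl // mulr_ge0.
apply: cV_norm_le => [|i]; first by rewrite mulr_ge0 // addr_ge0 // mulr_ge0.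
rewrite mxE; apply: (le_trans (ler_norm_sum _ _ _)).
apply: (@le_trans _ _ (\sum_(j < n) (`|M| * `|u|))).
  apply: ler_sum => j _; rewrite normrM ler_pM ?cV_norm_coord //.
  rewrite [leRHS]/Num.norm /= mx_normrE; apply/bigmax_geP; right => /=.
  by exists (i, j).
rewrite sumr_const card_ord -[leLHS]mulr_natl mulrA ler_wpM2r // lerDl //.
Qed.

Lemma mulmx_dot p n (M : 'M[R]_(p, n)) (u : 'cV[R]_n) v :
  dot v (M *m u) = dot (M^T *m v) u.
Proof.
have dotM k (a b : 'cV[R]_k) : dot a b = (a^T *m b) 0 0.
  by rewrite mxE; apply: eq_bigr => i _; rewrite mxE.
by rewrite !dotM trmx_mul trmxK mulmxA.
Qed.

(** Closed bounded sets of row vectors are compact, and transposition, which is 1-Lipschitz, carries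
    this over to columns. *)
Lemma cV_box_compact n (c : R) : compact [set u : 'cV[R]_n | `|u| <= c].
Proof.
have trn (k l : nat) (M : 'M[R]_(k, l)) : `|M^T| <= `|M|.
  rewrite [leLHS]/Num.norm /= mx_normrE; apply/bigmax_leP; split => //.
  case=> i j _ /=; rewrite mxE [leRHS]/Num.norm /= mx_normrE.
  by apply/bigmax_geP; right => /=; exists (j, i).
have tc (k l : nat) : continuous (@trmx R k l).
  apply: (@lip_continuous _ _ _ 1) => M N.
  by rewrite -linearB mul1r; exact: trn.
have -> : [set u : 'cV[R]_n | `|u| <= c] = trmx @` [set v : 'rV[R]_n | `|v^T| <= c].
  apply/seteqP; split => [u /= uc|_ [v /= vc <-] //].
  by exists u^T; rewrite ?trmxK.
apply: continuous_compact; first exact/continuous_subspaceT/tc.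
apply: bounded_closed_compact; last first.
  apply: (@closed_comp _ _ (fun v : 'rV[R]_n => `|v^T|) [set x | x <= c]).
    by move=> v _; apply: continuous_comp; [exact: tc|exact: norm_continuous].
  exact: closed_le.
exists c; split; first exact: num_real.
move=> b cb v /= vc; apply: le_trans (ltW cb).
by apply: le_trans vc; have := trn _ _ v^T; rewrite trmxK.
Qed.

End NormBounds.

(** * Differentials, gradients and Jacobians from first-order expansions *)

Section Frechet.
Context {R : realType}.

(** The epsilon estimate is the little-o expansion, and a continuous linear map in such an expansion
    is the differential by uniqueness. *)
Lemma frechet_differentiable (V W : normedModType R) (H : V -> W) x
    (D : {linear V -> W}) : continuous D ->
    (forall e, 0 < e ->
       \forall y \near x, `|H y - H x - D (y - x)| <= e * `|y - x|) ->
  differentiable H x /\ 'd H x = D :> (V -> W).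
Proof.
move=> cD HD.
have E : H \o shift x = cst (H x) + D +o_ 0 id.
  apply/eqaddoP => e e0; near=> y.
  have : `|H (y + x) - H x - D (y + x - x)| <= e * `|y + x - x|.
    near: y; have := HD _ e0; rewrite (near_shift 0); apply: filterS => z /=.
    by rewrite subr0.
  by rewrite addrK /= !fctE /= opprD addrA.
have dE := diff_unique cD E; split => //.
by apply/diff_locallyP; rewrite dE.
Unshelve. all: by end_near. Qed.

Lemma mulmx_continuous p n (M : 'M[R]_(p, n)) :
  continuous (fun u : 'cV[R]_n => M *m u).
Proof.
have [C C0 MC] := mulmx_norm_le M.
by apply: (@lip_continuous _ _ _ _ C) => u w; rewrite -mulmxBr.
Qed.

Lemma dot_continuous n (v : 'cV[R]_n) : continuous (dot v).
Proof.
apply: (@lip_continuous _ _ _ (dot v) (n%:R * `|v|)) => u w.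
by rewrite -dotNr -dotDr -mulrA dot_norm_le.
Qed.

Lemma frechet_grad n (H : 'cV[R]_n -> R) x g :
    (forall e, 0 < e ->
       \forall y \near x, `|H y - H x - dot g (y - x)| <= e * `|y - x|) ->
  differentiable (H : 'cV[R]_n -> R^o) x /\
  \col_i 'D_(delta_mx i 0) (H : 'cV[R]_n -> R^o) x = g.
Proof.
move=> Hg.
have lin : linear (fun u : 'cV[R]_n => dot g u : R^o).
  by move=> a u v; rewrite dotDr dotZr.
pose D : {linear 'cV[R]_n -> R^o} := HB.pack (fun u : 'cV[R]_n => dot g u : R^o)
  (GRing.isLinear.Build _ _ _ _ _ lin).
have cD : continuous D by exact: dot_continuous.
have [dH dHE] := frechet_differentiable cD Hg.
split=> //; apply/colP => i; rewrite mxE deriveE // dHE /=.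
by rewrite dotC dot_delta.
Qed.

Lemma frechet_jacobian n p (H : 'cV[R]_n -> 'cV[R]_p) x (M : 'M[R]_(p, n)) :
    (forall e, 0 < e ->
       \forall y \near x, `|H y - H x - M *m (y - x)| <= e * `|y - x|) ->
  differentiable H x /\
  \matrix_(i, j) ('D_(delta_mx j 0) H x) i 0 = M.
Proof.
move=> HM.
have lin : linear (fun u : 'cV[R]_n => M *m u).
  by move=> a u v; rewrite mulmxDr -scalemxAr.
pose D : {linear 'cV[R]_n -> 'cV[R]_p} := HB.pack (fun u : 'cV[R]_n => M *m u)
  (GRing.isLinear.Build _ _ _ _ _ lin).
have cD : continuous D by exact: mulmx_continuous.
have [dH dHE] := frechet_differentiable cD HM.
split=> //; apply/matrixP => i j; rewrite mxE deriveE // dHE /=.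
by rewrite -colE mxE.
Qed.

End Frechet.

(** * First-order negligible remainders *)

Section Negligible.
Context {R : realType} {V : normedModType R}.

Definition negligible_at (x : V) (E : V -> R) : Prop :=
  forall e, 0 < e -> \forall y \near x, `|E y| <= e * `|y - x|.

Lemma negligibleD x E1 E2 : negligible_at x E1 -> negligible_at x E2 ->
  negligible_at x (fun y => E1 y + E2 y).
Proof.
move=> H1 H2 e e0; have e20 : 0 < e / 2 by rewrite divr_gt0.
apply: filterS2 (H1 _ e20) (H2 _ e20) => y h1 h2.
by apply: (le_trans (ler_normD _ _)); lra.
Qed.

Lemma negligible_le x E1 E2 (C : R) : negligible_at x E1 ->
  (forall y, `|E2 y| <= C * `|E1 y|) -> negligible_at x E2.
Proof.
move=> H1 H2 e e0; have C0 : 0 < `|C| + 1 by rewrite ltr_wpDl.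
have eC0 : 0 < e / (`|C| + 1) by rewrite divr_gt0.
apply: filterS (H1 _ eC0) => y; rewrite mulrAC ler_pdivlMr // => h1.
apply: (le_trans (H2 y)); apply: le_trans h1; rewrite mulrC ler_wpM2l //.
by apply: (le_trans (ler_norm C)); rewrite lerDl.
Qed.

Lemma negligible_quadratic x E (C : R) :
  (forall y, `|E y| <= C * `|y - x| ^+ 2) -> negligible_at x E.
Proof.
move=> EC; apply: (@negligible_le x (fun y => `|y - x| ^+ 2) E C) => [e e0|y]; last first.
  by rewrite (ger0_norm (sqr_ge0 _)).
apply: filterS (nbhsx_ballx x _ e0) => y; rewrite -ball_normE /= distrC => xy.
by rewrite ger0_norm // expr2 ler_wpM2r // ltW.
Qed.

End Negligible.

(** Follows from differentiability: the remainder of the expansion with gradient [2 *: z] is exactly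
    [dot (w - z) (w - z)]. *)
Lemma dot_self_continuous (R : realType) n :
  continuous (fun z : 'cV[R]_n => dot z z).
Proof.
move=> z.
have [|dz _] := @frechet_grad _ _ (fun w => dot w w) z (2 *: z).
  apply: (@negligible_quadratic _ _ _ _ n%:R) => w.
  have -> : dot w w - dot z z - dot (2 *: z) (w - z) = dot (w - z) (w - z).
    by rewrite !dotE (dotC w z); ring.
  by rewrite expr2; exact: dot_norm_le.
exact: differentiable_continuous dz.
Qed.

(** * Entrywise convergence of vectors and products *)

Section MatrixConvergence.
Context {R : realType}.

Lemma cV_cvg n (I : Type) (F : set_system I) {FF : Filter F}
    (u : I -> 'cV[R]_n) (l : 'cV[R]_n) :
  (forall i, u x i 0 @[x --> F] --> l i 0) -> u x @[x --> F] --> l.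
Proof.
move=> ul; apply/cvgrPdist_le => e e0.
have : \forall x \near F, forall i, `|l i 0 - u x i 0| <= e.
  by apply: filter_forall => i; have /cvgrPdist_le/(_ _ e0) := ul i.
apply: filterS => x lx; apply: cV_norm_le => [|i]; first exact: ltW.
by rewrite !mxE.
Qed.

Lemma cvg_mulmx p n (I : Type) (F : set_system I) {FF : Filter F}
    (M : I -> 'M[R]_(p, n)) (u : I -> 'cV[R]_n) (M0 : 'M[R]_(p, n)) (u0 : 'cV[R]_n) :
  M x @[x --> F] --> M0 -> u x @[x --> F] --> u0 ->
  M x *m u x @[x --> F] --> M0 *m u0.
Proof.
move=> cM cu; apply: cV_cvg => i.
rewrite mxE; under eq_fun do rewrite mxE.
apply: cvg_big => [|j _]; first exact: add_continuous.
apply: cvgM.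
  have := @coord_continuous _ _ _ i j M0; exact: cvg_comp cM.
have := @coord_continuous _ _ _ j 0 u0; exact: cvg_comp cu.
Qed.

End MatrixConvergence.

(** * Conjugates of strongly convex functions *)

Section StronglyConvexConjugate.
Context {R : realType} {n : nat}.
Implicit Types (h : 'cV[R]_n -> \bar R) (v w x : 'cV[R]_n).

(** A selection from the inverse of the subdifferential; for closed strongly convex [h] with a
    subgradient somewhere, it is single-valued and is the gradient of [fenchel h]. *)
Definition conj_grad h v : 'cV[R]_n := get [set x | subdiff h x v].

(** Compare strong convexity on the segment from [x] to [w] with the subgradient inequality at an
    intermediate point, divide by [t] and let [t] tend to 0. *)
Lemma strongly_convex_growth h mu x v :
    (forall w, h w != -oo%E) -> 0 < mu -> strongly_convex mu h ->
    subdiff h x v -> forall w,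
  (h x + (dot v (w - x) + mu / 2 * dot (w - x) (w - x))%:E <= h w)%E.
Proof.
move=> hN mu0 hsc [hx hsub] w.
case: (h x) hx hsub (hsc w x) => [r| |] // _ hsub hconv.
have := hN w; case: (h w) hconv => [s hconv _| |] //; last by rewrite leey.
set a := dot v (w - x); set b := mu / 2 * dot (w - x) (w - x).
rewrite -EFinD lee_fin.
have key t : 0 < t -> t < 1 -> a + (1 - t) * b <= s - r.
  move=> t0 t1; have := hconv t t0 t1; have := hsub (t *: w + (1 - t) *: x).
  have := hN (t *: w + (1 - t) *: x).
  case: (h _) => [p _| |] //; rewrite -?EFinN -?EFinM -?EFinD ?lee_fin.
  have -> : t *: w + (1 - t) *: x - x = t *: (w - x).
    by rewrite scalerBl scale1r scalerBr addrA [in LHS]addrAC addrK.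
  rewrite -/a dotZr -/a => h1 h2.
  rewrite -(ler_pM2l t0).
  (* The three quadratic terms of strong convexity combine to [t * (1 - t) * b]. *)
  have -> : t * (a + (1 - t) * b) = r + t * a - (mu / 2 *
      dot (t *: w + (1 - t) *: x) (t *: w + (1 - t) *: x)) - r
      + t * (mu / 2 * dot w w) + (1 - t) * (mu / 2 * dot x x).
    by rewrite /b !dotE (dotC x w); field.
  by lra.
have b0 : 0 <= b by rewrite mulr_ge0 ?dot_ge0 // divr_ge0 // ltW.
rewrite leNgt; apply/negP => lt_s.
pose d := r + (a + b) - s.
have d0 : 0 < d by rewrite /d; lra.
have bd0 : 0 < 2 * (b + d) by lra.
(* In place of a limit: [key] would force [d <= t * b], while this [t] makes [t * b] at most
   [d / 2]. *)
have := key (d / (2 * (b + d))).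
rewrite divr_gt0 // ltr_pdivrMr // mul1r => /(_ isT) /(_ ltac:(lra)).
have : d / (2 * (b + d)) * b <= d / 2.
  by rewrite mulrAC ler_pdivrMr //; nra.
by rewrite /d; lra.
Qed.

(** Add the growth inequalities based at [x] and at [x']. *)
Lemma subdiff_monotone h mu x v x' v' :
    (forall w, h w != -oo%E) -> 0 < mu -> strongly_convex mu h ->
    subdiff h x v -> subdiff h x' v' ->
  mu * dot (x' - x) (x' - x) <= dot (v' - v) (x' - x).
Proof.
move=> hN mu0 hsc sx sx'.
have := strongly_convex_growth hN mu0 hsc sx x'.
have := strongly_convex_growth hN mu0 hsc sx' x.
case: sx => + _; case: sx' => + _.
case: (h x) => [r| |] //; case: (h x') => [s| |] // _ _.
by rewrite -?EFinD ?lee_fin !dotE (dotC x x'); lra.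
Qed.

Lemma subdiff_lip h mu x v x' v' :
    (forall w, h w != -oo%E) -> 0 < mu -> strongly_convex mu h ->
    subdiff h x v -> subdiff h x' v' ->
  `|x' - x| <= n%:R / mu * `|v' - v|.
Proof.
move=> hN mu0 hsc sx sx'.
have := subdiff_monotone hN mu0 hsc sx sx'.
have := dot_le_norm (v' - v) (x' - x); have := norm_sq_le_dot (x' - x).
set N := `|x' - x|; set M := `|v' - v|; set D := dot (x' - x) _.
move=> ND dM mD; have : 0 <= N by exact: normr_ge0.
rewrite le_eqVlt => /orP[/eqP <-|N0].
  by rewrite mulr_ge0 ?normr_ge0 // divr_ge0 // ltW.
rewrite mulrAC ler_pdivlMr // -(ler_pM2r N0).
by have := ler_wpM2l (ltW mu0) ND; lra.
Qed.

Lemma subdiff_unique h mu x v x' :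
    (forall w, h w != -oo%E) -> 0 < mu -> strongly_convex mu h ->
    subdiff h x v -> subdiff h x' v -> x' = x.
Proof.
move=> hN mu0 hsc sx /(subdiff_lip hN mu0 hsc sx).
by rewrite subrr normr0 mulr0 normr_le0 subr_eq0 => /eqP.
Qed.

(** Minimize [h - dot v] : quadratic growth at [x0] confines the sublevel set to a compact box.
    Minimizing over points of the epigraph uses closedness directly. *)
Lemma subdiff_exists h mu x0 v0 v :
    (forall w, h w != -oo%E) -> closed_fun h -> 0 < mu ->
    strongly_convex mu h -> subdiff h x0 v0 ->
  exists x, subdiff h x v.
Proof.
move=> hN hcl mu0 hsc s0.
have grow := strongly_convex_growth hN mu0 hsc s0.
have [hx0 _] := s0; have hxE : h x0 = (fine (h x0))%:E by rewrite fineK.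
set r0 := fine (h x0) in hxE.
(* On the sublevel set of [(x0, r0)], growth gives [mu / 2 * |w - x0|^2 <= n * |v - v0| * |w - x0|],
   so [b] bounds [|w - x0|]. Then [B] bounds [w], and [B'] bounds the height, which lies between
   [r0 + dot v0 (w - x0)] and [r0 + dot v (w - x0)]. *)
pose b := 2 * (n%:R / mu) * `|v - v0|.
have b0 : 0 <= b by rewrite mulr_ge0 // mulr_ge0 // divr_ge0 // ltW.
pose B := b + `|x0|; pose B' := `|r0| + n%:R * (`|v| + `|v0|) * b.
pose K := [set u : 'cV[R]_n | `|u| <= B] `*` [set` `[- B', B']].
have cK : compact K by apply: compact_setX; [exact: cV_box_compact|exact: segment_compact].
have cE : compact (epigraph h `&` K). by rewrite setIC; exact: compact_closedI.
pose phi (p : 'cV[R]_n * R) : R := p.2 - dot v p.1.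
have phic : continuous phi.
  move=> p; apply: cvgB; first exact: cvg_snd.
  by apply: continuous_comp; [exact: cvg_fst|exact: dot_continuous].
have inK w s : h w = s%:E -> phi (w, s) <= phi (x0, r0) -> K (w, s).
  rewrite /phi /= => hw le_phi.
  have := grow w; rewrite hxE hw -EFinD lee_fin.
  set D := dot (w - x0) _ => gw.
  have le1 := dot_le_norm (v - v0) (w - x0).
  have le2 := dot_le_norm v (w - x0).
  have := dot_norm_le v0 (w - x0); rewrite ler_norml => /andP[le3 _].
  have ND : `|w - x0| ^+ 2 <= D := norm_sq_le_dot _.
  rewrite !dotE in le1 le2 le3 gw; rewrite -/D in gw.
  have wb : `|w - x0| <= b.
    have : 0 <= `|w - x0| by [].
    rewrite le_eqVlt => /orP[/eqP <-//|N0].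
    rewrite /b mulrA mulrAC ler_pdivlMr // -(ler_pM2r N0).
    by have := ler_wpM2l (ltW mu0) ND; lra.
  split => /=.
    by rewrite -(subrK x0 w); apply: (le_trans (ler_normD _ _)); rewrite lerD2r.
  have lev : n%:R * (`|v| * `|w - x0|) <= n%:R * (`|v| * b).
    by rewrite !ler_wpM2l.
  have lev0 : n%:R * (`|v0| * `|w - x0|) <= n%:R * (`|v0| * b).
    by rewrite !ler_wpM2l.
  have D0 : 0 <= mu / 2 * D by rewrite mulr_ge0 ?dot_ge0 // divr_ge0 // ltW.
  have vb0 : 0 <= n%:R * (`|v| * b) by rewrite 2?mulr_ge0 ?normr_ge0 ?b0.
  have v0b0 : 0 <= n%:R * (`|v0| * b) by rewrite 2?mulr_ge0 ?normr_ge0 ?b0.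
  have r1 := ler_norm r0; have := ler_norm (- r0); rewrite normrN => r2.
  by rewrite in_itv /= /B'; apply/andP; split; lra.
have E0 : (epigraph h `&` K) (x0, r0).
  by split; [rewrite /epigraph /= hxE|exact: inK].
have [[x r]] := @compact_EVT_min _ _ phi _ (ex_intro _ _ E0) cE
  (continuous_subspaceT phic).
rewrite inE => -[/= hxr _] xmin.
have hxfin : h x \is a fin_num.
  by have := hN x; move: hxr; rewrite /epigraph /=; case: (h x).
exists x; split=> // w.
have := hN w; case hw : (h w) => [s| |] // _; last by rewrite leey.
have le_s : phi (x, r) <= phi (w, s).
  (* Outside the sublevel set [(w, s)] may leave [K], but there [phi] exceeds its value at
     [(x0, r0)], which is in [K]. *)
  have [/(inK _ _ hw) Kw|lt_phi] := leP (phi (w, s)) (phi (x0, r0)).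
    by apply: xmin; rewrite inE; split=> //; rewrite /epigraph /= hw.
  by apply: le_trans (ltW lt_phi); apply: xmin; rewrite inE.
move: hxr; rewrite /epigraph /= -(fineK hxfin) -EFinD !lee_fin.
by move: le_s; rewrite /phi /= !dotE; lra.
Qed.

Lemma conj_gradP h mu x0 v0 :
    (forall w, h w != -oo%E) -> closed_fun h -> 0 < mu ->
    strongly_convex mu h -> subdiff h x0 v0 ->
  forall v, subdiff h (conj_grad h v) v.
Proof.
move=> hN hcl mu0 hsc s0 v.
have [x sx] := subdiff_exists v hN hcl mu0 hsc s0.
exact: (@getI _ [set x | subdiff h x v] x).
Qed.

Lemma fenchel_subdiff h x v :
  subdiff h x v -> fenchel h v = (dot v x - fine (h x))%:E.
Proof.
move=> [hx hsub]; apply/eqP; rewrite eq_le; apply/andP; split.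
  apply: ge_ereal_sup => _ [w _ <-]; move: (hsub w).
  rewrite -(fineK hx); case: (h w) => [s| |] //=; last by rewrite addeNy leNye.
  by rewrite -EFinD -?EFinN -?EFinD !lee_fin !dotE; lra.
by apply: ereal_sup_ubound; exists x => //; rewrite EFinB fineK.
Qed.

Lemma fenchel_young h x v w (s : R) : h w = s%:E -> subdiff h x v ->
  dot v w - s <= fine (fenchel h v).
Proof.
move=> hw sx; rewrite (fenchel_subdiff sx) /=; case: sx => hx /(_ w).
by rewrite -(fineK hx) hw -EFinD lee_fin !dotE; lra.
Qed.

(** Fenchel-Young for the crossed pairs [(x, v')] and [(x', v)], with equality for the matching
    pairs. *)
Lemma fenchel_gradient_bounds h x v x' v' :
    subdiff h x v -> subdiff h x' v' ->
  0 <= fine (fenchel h v') - fine (fenchel h v) - dot x (v' - v)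
    <= dot (x' - x) (v' - v).
Proof.
move=> sx sx'.
have := fenchel_young (esym (fineK (proj1 sx))) sx'.
have := fenchel_young (esym (fineK (proj1 sx'))) sx.
rewrite (fenchel_subdiff sx) (fenchel_subdiff sx') /= !dotE.
rewrite (dotC v') (dotC v) (dotC v') (dotC v).
by move=> *; apply/andP; split; lra.
Qed.

(** Minimizers of [phi] are the points where [v] is a subgradient of [h]; strong convexity leaves
    only one, so the choice made by [argmin] is determined. *)
Lemma argmin_tilt h phi mu x v (c : R) :
    (forall w, h w != -oo%E) -> 0 < mu -> strongly_convex mu h ->
    subdiff h x v -> (forall w, phi w = (h w + (c - dot v w)%:E)%E) ->
  argmin phi = x.
Proof.
move=> hN mu0 hsc sx phiE.
have xmin : [set u | forall w, (phi u <= phi w)%E] x.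
  move=> w; rewrite !phiE; case: sx => hx /(_ w).
  rewrite -(fineK hx); have := hN w; case: (h w) => [s| |] // _; last by rewrite /= ?leey.
  by rewrite -!EFinD !lee_fin !dotE; lra.
have {}xmin : [set u | forall w, (phi u <= phi w)%E] (argmin phi) := getI xmin.
apply: (subdiff_unique hN mu0 hsc sx).
have hx := proj1 sx.
have := xmin x; rewrite !phiE -(fineK hx) => lex.
have hm : h (argmin phi) \is a fin_num.
  by have := hN (argmin phi); move: lex; case: (h (argmin phi)).
split=> // w; have := xmin w; rewrite !phiE -(fineK hm).
have := hN w; case: (h w) => [s| |] // _; last by rewrite /= ?leey.
by rewrite -!EFinD !lee_fin !dotE; lra.
Qed.

End StronglyConvexConjugate.

(** * Second-order quotients of the conjugate *)

Section SupremaConverge.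
Context {R : realType} {I : Type} {T : topologicalType}.

(* A cluster point of near-maximizers lies in the outer limit; lying also in the
   inner limit, it bounds all later suprema from below. *)
Lemma pk_sup_cvg (F : set_system I) {FF : ProperFilter F} (C : I -> set T)
    (u : T -> R) (c : I -> R) (e : I -> T) (K : set T) (M : R) :
    compact K -> continuous u ->
    outer_limit F C `<=` inner_limit F C ->
    (\forall i \near F, [/\ K (e i), C i (e i), u (e i) = c i
                          & forall p, C i p -> u p <= c i]) ->
    (\forall i \near F, `|c i| <= M) ->
  exists c0 : R, c i @[i --> F] --> c0.
Proof.
move=> cK uc outin att bnd.
(* [inf S] is the limsup of [c]. Elements of [S] close to it give the upper half of the convergence,
   leaving an eventual lower bound to prove. *)
pose S := [set t | \forall i \near F, c i <= t].
have SM : S M by apply: filterS bnd => i; exact: le_trans (ler_norm _).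
have lbS : has_lbound S.
  exists (- M) => t St; have [i [ci]] := filter_ex (filterI St bnd).
  by rewrite ler_norml => /andP[/le_trans le_M _]; exact: le_M.
have infS : has_inf S by split => //; exists M.
exists (inf S); apply/cvgrPdist_le => eps eps0.
have [t St tlt] := inf_adherent eps0 infS.
suff low : \forall i \near F, inf S - eps <= c i.
  apply: filterS2 St low => i cit lowi.
  by rewrite ler_distl; apply/andP; split; lra.
(* [W] occurs frequently, since otherwise [inf S - eps / 2] would belong to [S]; hence [within W F]
   is proper and the maximizers [e i] cluster along it. *)
pose W := [set i | inf S - eps / 2 < c i].
have WF : ProperFilter (within W F).
  apply: Build_ProperFilter => nW.
  suff /(ge_inf lbS) : S (inf S - eps / 2) by lra.
  by apply: (@filterS _ F _ _ _ _ nW) => i Wi; rewrite leNgt; apply/negP => /Wi.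
have eK : (e i @[i --> within W F]) K.
  by apply: (@filterS _ F _ _ _ _ att) => i [].
have [p [_ clp]] := cK _ _ eK.
have out_p : outer_limit F C p.
  move=> V U nV FU.
  have [|_ [[i [Ui Cie] <-] Vei]] := clp (e @` [set i | U i /\ C i (e i)]) V _ nV.
    have near_UC : \forall i \near F, U i /\ C i (e i).
      by apply: filterS2 FU att => i Ui [].
    by apply: (@filterS _ F _ _ _ _ near_UC) => i UCi _; exists i.
  by exists i => //; exists (e i).
have up : inf S - eps / 2 - eps / 4 <= u p.
  rewrite leNgt; apply/negP => ult.
  have nV : nbhs p [set q | u q < inf S - eps / 2].
    by apply: (cvgr_lt (u p) (uc p)); lra.
  have [|_ [[i [Wi uei] <-] /= lti]] :=
      clp (e @` [set i | W i /\ u (e i) = c i]) _ _ nV.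
    by apply: (@filterS _ F _ _ _ _ att) => i [_ _ uei _] Wi; exists i.
  by move: Wi; rewrite /W /= -uei; lra.
(* The inner limit puts points of every late [C i] in this neighbourhood, and each bounds [c i] from
   below. *)
have nV : nbhs p [set q | inf S - eps < u q].
  by apply: (cvgr_gt (u p) (uc p)); lra.
apply: filterS2 (outin _ out_p _ nV) att => i [q [Ciq /= ltq]] [_ _ _ sup_i].
by apply: ltW; apply: lt_le_trans ltq (sup_i _ Ciq).
Qed.

End SupremaConverge.

(** * Quotients of the conjugate as suprema over epigraphs *)

Section StrictSecondOrder.
Context {R : realType} {n : nat}.
Variables (h : 'cV[R]_n -> \bar R) (mu : R).
Hypotheses (h_ninfty : forall w, h w != -oo%E) (mu_gt0 : 0 < mu)
  (h_sconvex : strongly_convex mu h).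
Local Notation G := (conj_grad h).
Local Notation F := (fun v => fine (fenchel h v)).
Hypothesis G_subdiff : forall v, subdiff h (G v) v.

Lemma conj_grad_lip v v' : `|G v' - G v| <= n%:R / mu * `|v' - v|.
Proof. exact: subdiff_lip h_ninfty mu_gt0 h_sconvex _ _. Qed.

Lemma conj_grad_continuous : continuous G.
Proof. by apply: (@lip_continuous _ _ _ _ (n%:R / mu)) => u w; exact: conj_grad_lip. Qed.

(** Half the usual second-order quotient, so that it is the supremum of [dot w d - r / 2] over the
    epigraph of [quot2 h], as the next lemmas show. *)
Definition conj_quot (w : 'cV[R]_n) (p : R * 'cV[R]_n) : R :=
  (F (p.2 + p.1 *: w) - F p.2 - p.1 * dot (G p.2) w) / p.1 ^+ 2.

Local Notation Phi v := (filter_prod (0 : R)^'+ (nbhs (v : 'cV[R]_n))).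

Lemma near_tau_gt0 v : \forall p \near Phi v, 0 < p.1.
Proof. exact: (@cvg_fst _ _ (0 : R)^'+ (nbhs v) _ _ (nbhs_right_gt (0 : R))). Qed.

Lemma conj_quot_ub w (p : R * 'cV[R]_n) d r : 0 < p.1 ->
    epigraph (quot2 h p.1 (G p.2) p.2) (d, r) ->
  dot w d - r / 2 <= conj_quot w p.
Proof.
case: p => tau v /= tau0; rewrite /epigraph /quot2 /=.
have Gv := G_subdiff v; have Gw := G_subdiff (v + tau *: w).
have := h_ninfty (G v + tau *: d).
have := @fenchel_young _ _ h (G (v + tau *: w)) (v + tau *: w) (G v + tau *: d).
have t20 : 0 < tau ^+ 2 by rewrite exprn_gt0.
rewrite -(fineK (proj1 Gv)).
case: (h (G v + _)) => [s| |] //; last first.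
  by move=> _ _; rewrite /= mulyr gtr0_sg ?mul1e // invr_gt0 divr_gt0.
move=> /(_ _ erefl Gw) yg _; rewrite -!EFinB -EFinM lee_fin.
rewrite ler_pdivrMr ?divr_gt0 // => epi.
rewrite ler_pdivlMr //=; move: yg.
rewrite (fenchel_subdiff Gv) /= !dotE (dotC (G v)) => yg.
have -> : (dot w d - r / 2) * tau ^+ 2 = tau ^+ 2 * dot w d - r * (tau ^+ 2 / 2).
  by field.
by rewrite expr2; rewrite expr2 in epi; lra.
Qed.

(** The maximizing direction: moving from [G p.2] by [p.1] times it reaches [G (p.2 + p.1 *: w)],
    where Fenchel-Young is an equality. *)
Definition conj_arg w (p : R * 'cV[R]_n) : 'cV[R]_n :=
  p.1^-1 *: (G (p.2 + p.1 *: w) - G p.2).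

Lemma conj_quot_attained w (p : R * 'cV[R]_n) : 0 < p.1 ->
  epigraph (quot2 h p.1 (G p.2) p.2)
    (conj_arg w p, 2 * (dot w (conj_arg w p) - conj_quot w p)).
Proof.
case: p => tau v /= tau0; rewrite /epigraph /quot2 /conj_arg /=.
rewrite scalerA divff ?gt_eqF // scale1r [G v + _]addrC subrK.
have Gv := G_subdiff v; have Gw := G_subdiff (v + tau *: w).
rewrite -(fineK (proj1 Gv)) -(fineK (proj1 Gw)) -!EFinB -EFinM lee_fin.
rewrite /conj_quot /= (fenchel_subdiff Gv) (fenchel_subdiff Gw) /= !dotE.
rewrite (dotC (G v)) le_eqVlt; apply/orP; left; apply/eqP.
by field; rewrite gt_eqF.
Qed.

Lemma conj_arg_bound w p : 0 < p.1 -> `|conj_arg w p| <= n%:R / mu * `|w|.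
Proof.
move=> tau0; rewrite normrZ gtr0_norm ?invr_gt0 // ler_pdivrMl //.
apply: (le_trans (conj_grad_lip _ _)).
by rewrite addrAC subrr add0r normrZ gtr0_norm // mulrCA.
Qed.

Lemma conj_quot_bound w (p : R * 'cV[R]_n) : 0 < p.1 ->
  0 <= conj_quot w p <= n%:R * (`|w| * (n%:R / mu * `|w|)).
Proof.
case: p => tau v tau0; rewrite /= in tau0.
have := fenchel_gradient_bounds (G_subdiff v) (G_subdiff (v + tau *: w)).
have -> : v + tau *: w - v = tau *: w by rewrite addrAC subrr add0r.
rewrite !dotZr => /andP[F0 Fle].
have t20 : 0 < tau ^+ 2 by rewrite exprn_gt0.
apply/andP; split; first by rewrite divr_ge0 // ltW.
apply: (@le_trans _ _ (dot w (conj_arg w (tau, v)))).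
  rewrite /conj_quot /= ler_pdivrMr //; apply: (le_trans Fle).
  rewrite /conj_arg /= dotZr (dotC w).
  rewrite le_eqVlt; apply/orP; left; apply/eqP.
  by field; rewrite gt_eqF.
apply: (le_trans (dot_le_norm _ _)).
by rewrite !ler_wpM2l // conj_arg_bound.
Qed.

Lemma graph_cvg_strict v : ((p.1, G p.2), p.2) @[p --> Phi v]
  --> strict_filter h (G v) v.
Proof.
move=> W sW.
have : ((p.1, G p.2), p.2) @[p --> Phi v]
    --> filter_prod (filter_prod (0 : R)^'+ (nbhs (G v))) (nbhs v).
  have c1 : p.1 @[p --> Phi v] --> (0 : R)^'+ by exact: cvg_fst.
  have c3 : p.2 @[p --> Phi v] --> nbhs v by exact: cvg_snd.
  have c2 : G p.2 @[p --> Phi v] --> nbhs (G v).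
    by have cG := @conj_grad_continuous v; exact: cvg_comp c3 cG.
  exact: (cvg_pair (cvg_pair c1 c2) c3).
move=> /(_ _ sW); apply: (@filterS _ (Phi v)) => p Wp.
exact: Wp (G_subdiff p.2).
Qed.

Lemma conj_quot_cvg v w :
    strictly_twice_epi_differentiable_for h (G v) v ->
  exists c : R, conj_quot w p @[p --> Phi v] --> c.
Proof.
move=> [l [inE outE]].
pose M := n%:R * (`|w| * (n%:R / mu * `|w|)).
pose arg p : 'cV[R]_n * R :=
  (conj_arg w p, 2 * (dot w (conj_arg w p) - conj_quot w p)).
apply: (@pk_sup_cvg _ _ _ _ _ (fun p => epigraph (quot2 h p.1 (G p.2) p.2))
  (fun q => dot w q.1 - q.2 / 2) _ arg
  (* The height is [2 * (dot w d - c)] with [|dot w d| <= M] and [0 <= c <= M], hence at most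
     [4 * M] in absolute value. *)
  ([set u | `|u| <= n%:R / mu * `|w|] `*` [set` `[- (4 * M), 4 * M]]) M).
- by apply: compact_setX; [exact: cV_box_compact|exact: segment_compact].
- move=> q; apply: cvgB.
    by apply: continuous_comp; [exact: cvg_fst|exact: dot_continuous].
  by apply: cvgMl; exact: cvg_snd.
(* Along the finer filter the outer limit shrinks and the inner limit grows; along [strict_filter]
   both equal [epigraph l]. *)
- move=> q outq.
  have : epigraph l q.
    rewrite -outE => V W nV /graph_cvg_strict sW.
    by have [p Wp CV] := outq V _ nV sW; exists ((p.1, G p.2), p.2).
  by rewrite -inE => inq V /inq /graph_cvg_strict.
- apply: filterS (near_tau_gt0 v) => p tau0.
  split; [split => /=| |rewrite /=; lra|].
  + exact: conj_arg_bound.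
  + have /andP[q0 qM] := conj_quot_bound w tau0; rewrite -/M in qM.
    have := dot_norm_le w (conj_arg w p).
    have : n%:R * (`|w| * `|conj_arg w p|) <= M.
      by rewrite !ler_wpM2l // conj_arg_bound.
    move=> /[swap] /le_trans /[apply]; rewrite ler_norml => /andP[d1 d2].
    by rewrite in_itv /=; apply/andP; split; lra.
  + exact: conj_quot_attained.
  + by case=> d r; exact: conj_quot_ub.
- apply: filterS (near_tau_gt0 v) => p tau0.
  by have /andP[q0 qM] := conj_quot_bound w tau0; rewrite ger0_norm.
Qed.

End StrictSecondOrder.

(** * Strict differentiability *)

Section StrictDifferentiability.
Context {R : realType} {n : nat}.
Implicit Types (v w : 'cV[R]_n).

(** Both end points vary, unlike in differentiability at [v]; this uniformity yields continuity of
    the Jacobian. *)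
Definition strict_frechet p (H : 'cV[R]_n -> 'cV[R]_p) v (M : 'M[R]_(p, n)) :=
  forall eps : R, 0 < eps -> exists2 d : R, 0 < d &
    forall a b, `|a - v| < d -> `|b - v| < d ->
      `|H b - H a - M *m (b - a)| <= eps * `|b - a|.

(* Walk from a to b along the coordinate axes, one coordinate at a time. *)
Definition hybrid (a b : 'cV[R]_n) (k : nat) : 'cV[R]_n :=
  \col_i (if (i < k)%N then b i 0 else a i 0).

Lemma hybrid0 a b : hybrid a b 0 = a.
Proof. by apply/colP => i; rewrite mxE. Qed.

Lemma hybridn a b : hybrid a b n = b.
Proof. by apply/colP => i; rewrite mxE ltn_ord. Qed.

Lemma hybridS a b (k : 'I_n) :
  hybrid a b k.+1 = hybrid a b k + (b k 0 - a k 0) *: delta_mx k 0.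
Proof.
apply/colP => i; rewrite !mxE andbT ltnS.
have [->|ik] := eqVneq i k; first by rewrite leqnn ltnn mulr1 addrC subrK.
by rewrite mulr0 addr0 leq_eqVlt (_ : (i == k :> nat) = false) //; exact: negbTE.
Qed.

(** Every coordinate comes from [a] or [b], so sup-norm balls contain the whole walk. *)
Lemma hybrid_dist a b v (d : R) k : `|a - v| < d -> `|b - v| < d ->
  `|hybrid a b k - v| < d.
Proof.
move=> ad bd; apply: (@le_lt_trans _ _ (Num.max `|a - v| `|b - v|)).
  apply: cV_norm_le => [|i]; first by rewrite le_max normr_ge0.
  rewrite !mxE le_max; case: ifP => _.
    by apply/orP; right; have := cV_norm_coord (b - v) i; rewrite !mxE.
  by apply/orP; left; have := cV_norm_coord (a - v) i; rewrite !mxE.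
by rewrite gt_max ad.
Qed.

Lemma increment_split p (H : 'cV[R]_n -> 'cV[R]_p) M a b :
  H b - H a - M *m (b - a) = (H b - M *m b) - (H a - M *m a).
Proof. by rewrite mulmxBr !opprD !opprK addrACA. Qed.

Lemma norm_delta_le (t : R) (j : 'I_n) :
  0 < t -> `|t *: (delta_mx j 0 : 'cV[R]_n)| <= t.
Proof.
move=> t0; apply: cV_norm_le => [|i]; first exact: ltW.
rewrite !mxE andbT; case: (i == j); last by rewrite mulr0 normr0 ltW.
by rewrite mulr1 gtr0_norm.
Qed.

(** Telescope along the hybrids: each step is a one-coordinate increment of length at most
    [|b - a|]. *)
Lemma strict_frechet_partials p (H : 'cV[R]_n -> 'cV[R]_p) v M :
    (forall eps : R, 0 < eps -> exists2 d : R, 0 < d &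
      forall a (t : R) j, 0 < t -> t < d -> `|a - v| < d ->
       `|H (a + t *: delta_mx j 0) - H a - t *: col j M| <= eps * t) ->
  strict_frechet H v M.
Proof.
move=> HM eps eps0.
(* The [n] steps share [eps]; dividing by [n.+1] also covers dimension 0. *)
have eps'0 : 0 < eps / n.+1%:R by rewrite divr_gt0.
have [d d0 Hd] := HM _ eps'0.
(* Halving makes [|b - a|], hence each step length, smaller than [d]. *)
exists (d / 2); first by rewrite divr_gt0.
move=> a b ad bd; pose f k := H (hybrid a b k) - M *m hybrid a b k.
have -> : H b - H a - M *m (b - a) = \sum_(k < n) (f k.+1 - f k).
  rewrite -(big_mkord xpredT (fun k => f k.+1 - f k)) telescope_sumr //.
  by rewrite /f hybrid0 hybridn increment_split.
apply: (le_trans (ler_norm_sum _ _ _)).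
apply: (@le_trans _ _ (\sum_(k < n) (eps / n.+1%:R * `|b - a|))); last first.
  rewrite sumr_const card_ord -[leLHS]mulr_natl mulrA ler_wpM2r //.
  by rewrite mulrCA ger_pMr // ler_pdivrMr // mul1r ler_nat.
apply: ler_sum => k _.
set t := b k 0 - a k 0.
have tba : `|t| <= `|b - a|.
  by have := cV_norm_coord (b - a) k; rewrite !mxE.
have td : `|t| < d.
  apply: (le_lt_trans tba); rewrite -(subrK v b) -addrA -[v - a]opprB.
  by apply: (le_lt_trans (ler_normB _ _)); lra.
suff: `|f k.+1 - f k| <= eps / n.+1%:R * `|t|.
  by move=> /le_trans; apply; rewrite ler_wpM2l // ltW.
have hd j : `|hybrid a b j - v| < d.
  by apply: lt_trans (hybrid_dist j ad bd) _; rewrite ltr_pdivrMr //; lra.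
rewrite /f; set q := hybrid a b k; have qS : hybrid a b k.+1 = q + t *: delta_mx k 0.
  exact: hybridS.
have [t0|t0|t0] := ltgtP t 0.
(* The hypothesis treats positive increments only, so a negative step is walked backwards from its
   end. *)
- have qE : q = hybrid a b k.+1 + (- t) *: delta_mx k 0.
    by rewrite qS scaleNr addrK.
  rewrite ltr0_norm // in td *; rewrite distrC -increment_split {1}qE.
  have -> : q - hybrid a b k.+1 = (- t) *: delta_mx k 0.
    by rewrite qS opprD addNKr scaleNr.
  by rewrite -scalemxAr -colE; apply: Hd; rewrite ?oppr_gt0.
- rewrite gtr0_norm // in td *; rewrite -increment_split qS.
  rewrite [q + _ - q]addrAC subrr add0r -scalemxAr -colE.
  exact: (Hd _ t k t0 td (hd k)).
- by rewrite qS t0 scale0r addr0 subrr !normr0 mulr0.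
Qed.

Lemma strict_frechet_diff p (H : 'cV[R]_n -> 'cV[R]_p) v M :
  strict_frechet H v M ->
  differentiable H v /\ \matrix_(i, j) ('D_(delta_mx j 0) H v) i 0 = M.
Proof.
move=> HM; apply: frechet_jacobian => eps eps0.
have [d d0 Hd] := HM _ eps0.
apply: filterS (nbhsx_ballx v d d0) => y; rewrite -ball_normE /= => vy.
by apply: Hd; rewrite 1?distrC // subrr normr0.
Qed.

(** [J w] and [J v] both approximate the same increment of [H] over a short coordinate step from
    [w], so their columns are close. *)
Lemma strict_frechet_continuous p (H : 'cV[R]_n -> 'cV[R]_p) (J : 'cV[R]_n -> 'M[R]_(p, n)) v :
    (\forall w \near v, strict_frechet H w (J w)) ->
  {for v, continuous J}.
Proof.
move=> HJ; apply/(@cvgrPdist_le _ _ _ (nbhs v)) => eps eps0.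
have [d d0 Hd] := nbhs_singleton HJ (eps / 2) ltac:(lra).
have d20 : 0 < d / 2 by rewrite divr_gt0.
apply: filterS2 HJ (nbhsx_ballx v _ d20) => w Hw; rewrite -ball_normE /= => wd.
have [r r0 Hr] := Hw (eps / 2) ltac:(lra).
(* [t < r] allows the estimate at [w], and [t <= d / 2] keeps [w + D] in the [d]-ball around [v]. *)
pose t := Num.min (r / 2) (d / 2).
have t0 : 0 < t by rewrite lt_min !divr_gt0.
have tr : t < r by rewrite /t gt_min; apply/orP; left; lra.
have td : t <= d / 2 by rewrite /t ge_min lexx orbT.
rewrite [leLHS]/Num.norm /= mx_normrE; apply/bigmax_leP; split; first exact: ltW.
case=> i j _ /=; rewrite !mxE.
have dl := norm_delta_le j t0; set D := t *: _ in dl.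
have wD : w + D - w = D by rewrite addrAC subrr add0r.
have := Hr w (w + D); rewrite subrr normr0 wD => /(_ r0 (le_lt_trans dl tr)) lew.
have := Hd w (w + D); rewrite distrC wD => lev.
have {lev} := lev ltac:(lra); rewrite addrAC => lev.
have {lev} := lev (le_lt_trans (ler_normD _ _) _).
rewrite distrC => lev; have {lev} := lev ltac:(lra) => lev.
have sum_le : `|(J w - J v) *m D| <= eps * t.
  rewrite mulmxBl -[J w *m D](subKr (H (w + D) - H w)) addrAC.
  apply: (le_trans (ler_normB _ _)).
  have le1 := ler_wpM2l (ltW eps0) dl.
  by apply: (le_trans (lerD lev lew)); lra.
have := le_trans (cV_norm_coord _ i) sum_le.
rewrite -scalemxAr -colE !mxE normrM gtr0_norm // mulrC ler_pM2r //.
by rewrite distrC.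
Qed.

End StrictDifferentiability.

(** * First- and second-order smoothness of the conjugate *)

Section ConjugateSmoothness.
Context {R : realType} {n : nat}.
Variables (h : 'cV[R]_n -> \bar R) (mu : R).
Hypotheses (h_ninfty : forall w, h w != -oo%E) (mu_gt0 : 0 < mu)
  (h_sconvex : strongly_convex mu h).
Local Notation G := (conj_grad h).
Local Notation F := (fun v => fine (fenchel h v)).
Hypothesis G_subdiff : forall v, subdiff h (G v) v.

Lemma fenchel_taylor v v' :
  `|F v' - F v - dot (G v) (v' - v)| <= n%:R * (n%:R / mu) * `|v' - v| ^+ 2.
Proof.
have /andP[F0 Fle] := fenchel_gradient_bounds (G_subdiff v) (G_subdiff v').
rewrite ger0_norm //; apply: (le_trans Fle).
apply: (le_trans (dot_le_norm _ _)); rewrite -mulrA ler_wpM2l // expr2 mulrA.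
by rewrite ler_wpM2r // (conj_grad_lip h_ninfty mu_gt0 h_sconvex G_subdiff).
Qed.

Lemma fenchel_fin_num v : fenchel h v \is a fin_num.
Proof. by rewrite (fenchel_subdiff (G_subdiff v)). Qed.

Lemma fenchel_grad v : ediff (fenchel h) v /\ grad (fenchel h) v = G v.
Proof.
have [dF gF] := frechet_grad (negligible_quadratic (fenchel_taylor v)).
by split=> //; split=> //; apply: (@filterE _ (nbhs v)) => w; exact: fenchel_fin_num.
Qed.

Lemma fenchel_gradE : grad (fenchel h) = G.
Proof. by apply/funext => v; have [] := fenchel_grad v. Qed.

Lemma strict_frechet_hess v M :
  strict_frechet G v M -> twice_ediff (fenchel h) v /\ hess (fenchel h) v = M.
Proof.
move=> /strict_frechet_diff[dG GM]; rewrite /twice_ediff /hess fenchel_gradE.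
by split=> //; split=> //; apply: (@filterE _ (nbhs v)) => w; have [] := fenchel_grad w.
Qed.

(** With the last quotient based at the shifted point [v + t *: u], all values of the conjugate
    cancel and only gradients remain. *)
Lemma conj_quot_polar (u w v : 'cV[R]_n) (t : R) : t != 0 ->
  dot w (G (v + t *: u) - G v) / t =
  conj_quot h (u + w) (t, v) - conj_quot h u (t, v)
  - conj_quot h w (t, v + t *: u).
Proof.
move=> t0; rewrite /conj_quot /= scalerDr addrA !dotE.
rewrite (dotC w (G (v + _))) (dotC w (G v)).
by field.
Qed.

(* Polarizing the limit quotients yields a matrix that is symmetric by
   construction, so the limit needs no a priori quadratic form. *)
Lemma conj_grad_strict_frechet v :
    strictly_twice_epi_differentiable_for h (G v) v ->
  exists2 M : 'M[R]_n, M^T = M & strict_frechet G v M.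
Proof.
move=> hv.
have /choice[cc ccP] :=
  fun w => conj_quot_cvg h_ninfty mu_gt0 h_sconvex G_subdiff w hv.
pose e (j : 'I_n) : 'cV[R]_n := delta_mx j 0.
pose M : 'M[R]_n := \matrix_(i, j) (cc (e j + e i) - cc (e j) - cc (e i)).
exists M.
  by apply/matrixP => i j; rewrite !mxE (addrC (e i)) addrAC.
have t_cvg : p.1 @[p --> filter_prod (0 : R)^'+ (nbhs v)] --> (0 : R).
  have c1 : p.1 @[p --> filter_prod (0 : R)^'+ (nbhs v)] --> (0 : R)^'+.
    exact: cvg_fst.
  by apply: cvg_trans c1 _; exact: cvg_within.
(* The shifted base points also tend to [v], so the shifted quotient has the same limit [cc]. *)
have shift_cvg u : (p.1, p.2 + p.1 *: u) @[p --> filter_prod (0 : R)^'+ (nbhs v)]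
    --> filter_prod (0 : R)^'+ (nbhs v).
  have c1 : p.1 @[p --> filter_prod (0 : R)^'+ (nbhs v)] --> (0 : R)^'+.
    exact: cvg_fst.
  have c2 : p.2 @[p --> filter_prod (0 : R)^'+ (nbhs v)] --> v by exact: cvg_snd.
  have c3 : p.2 + p.1 *: u @[p --> filter_prod (0 : R)^'+ (nbhs v)] --> v.
    rewrite -[X in _ --> X]addr0 -(scale0r u); apply: cvgD => //.
    exact: cvgZl.
  exact: cvg_pair c1 c3.
have ent i j : (G (p.2 + p.1 *: e j) - G p.2) i 0 / p.1
    @[p --> filter_prod (0 : R)^'+ (nbhs v)] --> M i j.
  rewrite mxE.
  have : conj_quot h (e j + e i) p - conj_quot h (e j) p
      - conj_quot h (e i) (p.1, p.2 + p.1 *: e j)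
      @[p --> filter_prod (0 : R)^'+ (nbhs v)]
      --> cc (e j + e i) - cc (e j) - cc (e i).
    apply: cvgB; first by apply: cvgB; exact: ccP.
    exact: cvg_comp (shift_cvg (e j)) (ccP (e i)).
  apply: cvg_trans; apply: near_eq_cvg.
  apply: filterS (near_tau_gt0 v) => -[t w] /= t0.
  by rewrite -conj_quot_polar ?gt_eqF // dot_delta.
apply: strict_frechet_partials => eps eps0.
have : \forall p \near filter_prod (0 : R)^'+ (nbhs v), forall i j,
    `|M i j - (G (p.2 + p.1 *: e j) - G p.2) i 0 / p.1| <= eps.
  apply: filter_forall => i; apply: filter_forall => j.
  by have /cvgrPdist_le/(_ _ eps0) := ent i j.
(* A set of the product filter contains a box, so one radius serves all base points and step lengths
   at once. *)
case=> -[/= U V] [/nbhs_ballP[d1 /= d10 dU] /nbhs_ballP[d2 /= d20 dV]] UV.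
exists (Num.min d1 d2); first by rewrite lt_min d10.
move=> a t j t0; rewrite !lt_min => /andP[td1 _] /andP[_ ad2].
have Ut : U t.
  by apply: dU => //; rewrite -ball_normE /= sub0r normrN gtr0_norm.
have Va : V a by apply: dV; rewrite -ball_normE /= distrC.
have {UV}UV := UV (t, a) (conj Ut Va).
apply: cV_norm_le => [|i]; first by rewrite mulr_ge0 // ltW.
have := UV i j; rewrite /= -(ler_pM2r t0) -[X in `|_| * X](gtr0_norm t0) -normrM.
rewrite mulrBl divfK ?gt_eqF // distrC.
by congr (`|_| <= _); rewrite !mxE [_ * t]mulrC.
Qed.

End ConjugateSmoothness.

(** * The dual function *)

Section ProximalTilt.
Context {R : realType} {m : nat}.
Variables (g : 'cV[R]_m -> \bar R) (gamma : R).
Hypothesis gamma_gt0 : 0 < gamma.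

(** For fixed [x] with [f x] finite, the augmented Lagrangian in [z] is this function minus a linear
    one, up to a constant. *)
Definition prox_tilt (z : 'cV[R]_m) : \bar R :=
  (g z + (gamma / 2 * dot z z)%:E)%E.

Lemma prox_tilt_ninfty :
  (forall z, g z != -oo%E) -> forall z, prox_tilt z != -oo%E.
Proof. by move=> gN z; rewrite /prox_tilt; have := gN z; case: (g z). Qed.

Lemma prox_tilt_sconvex : convex_efun g -> strongly_convex gamma prox_tilt.
Proof.
rewrite /strongly_convex; congr convex_efun; apply/funext => z.
by rewrite /prox_tilt addeK.
Qed.

(** The epigraph is the preimage of that of [g] under the continuous shear [T]. *)
Lemma prox_tilt_closed : closed_fun g -> closed_fun prox_tilt.
Proof.
move=> gcl; rewrite /closed_fun.
pose T (p : 'cV[R]_m * R) := (p.1, p.2 - gamma / 2 * dot p.1 p.1).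
have -> : epigraph prox_tilt = T @^-1` epigraph g.
  apply/seteqP; split=> -[z r]; rewrite /epigraph /prox_tilt /T /=.
    by case: (g z) => [s| |] //=; rewrite -?EFinD ?lee_fin ?leNye //; lra.
  by case: (g z) => [s| |] //=; rewrite -?EFinD ?lee_fin ?leNye //; lra.
apply: preimage_closed => // p _.
have c1 : q.1 @[q --> nbhs p] --> p.1 by exact: cvg_fst.
have c2 : q.2 - gamma / 2 * dot q.1 q.1 @[q --> nbhs p]
    --> p.2 - gamma / 2 * dot p.1 p.1.
  apply: cvgB; first exact: cvg_snd.
  apply: cvgMr.
  apply: (@continuous_comp _ _ _ fst (fun z : 'cV[R]_m => dot z z)) => //.
  exact: dot_self_continuous.
exact: (cvg_pair c1 c2).
Qed.

(** Provides the initial subgradient from which [conj_gradP] obtains all others. *)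
Lemma prox_tilt_subdiff z y :
  subdiff g z y -> subdiff prox_tilt z (y + gamma *: z).
Proof.
move=> [gz gsub]; rewrite /prox_tilt; split; first by rewrite fin_numD gz.
move=> w; have := gsub w; rewrite -(fineK gz).
case: (g w) => [s| |] //; last by rewrite /= ?leey.
rewrite -!EFinD !lee_fin !dotE => le_s.
have := mulr_ge0 (ltW gamma_gt0) (dot_ge0 (w - z)); rewrite !dotE (dotC w z).
by lra.
Qed.

End ProximalTilt.

(** The algebra behind [dual_value_frechet]: the left side lists four remainders, with [d] the
    increment of [y] and [X] standing for [A *m M *m A^T *m d]. *)
Lemma dual_increment_identity (R : realType) m (gamma F0 F1 K0 K1 : R)
    (a a' z d X : 'cV[R]_m) :
  (F1 - F0 - - dot a d) + (K1 - K0 - dot z (d + gamma *: (a' - a))) +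
  (- (gamma / 2 * dot (a' - a) (a' - a)) + gamma * dot (z - a) (a' - a + X)) =
  F1 + K1 - gamma / 2 * dot a' a' - (F0 + K0 - gamma / 2 * dot a a) -
  (dot (z - a) d - gamma * dot (z - a) X).
Proof. by rewrite !dotE (dotC a' a); field. Qed.

(** * Gradient of the dual function *)

Section DualFunction.
Context {R : realType} {n m : nat}.
Variables (A : 'M[R]_(m, n)) (f : 'cV[R]_n -> \bar R) (g : 'cV[R]_m -> \bar R).
Variables (mu gamma : R).
Hypotheses (f_ninfty : forall x, f x != -oo%E) (mu_gt0 : 0 < mu)
  (f_sconvex : strongly_convex mu f).
Hypotheses (g_ninfty : forall z, g z != -oo%E) (g_convex : convex_efun g)
  (gamma_gt0 : 0 < gamma).
Local Notation k := (prox_tilt g gamma).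
Hypothesis f_grad : forall v, subdiff f (conj_grad f v) v.
Hypothesis k_grad : forall u, subdiff k (conj_grad k u) u.

Let k_ninfty := prox_tilt_ninfty gamma g_ninfty.
Let k_sconvex := prox_tilt_sconvex gamma g_convex.

(** [conj_grad f (v_ y)] and [z_ y] turn out to be the two minimizers; [u_ y] is the slope left
    after completing the square in [z]. *)
Let v_ (y : 'cV[R]_m) : 'cV[R]_n := - (A^T *m y).
Let a_ y := A *m conj_grad f (v_ y).
Let u_ y := y + gamma *: a_ y.
Let z_ y := conj_grad k (u_ y).

Lemma x_ofE y : x_of A f y = conj_grad f (v_ y).
Proof.
apply: (@argmin_tilt _ _ f _ mu _ (v_ y) 0) => // x.
by rewrite /v_ sub0r dotNl opprK mulmx_dot.
Qed.

Lemma aug_lagrangianE x z y (r : R) : f x = r%:E ->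
  aug_lagrangian A f g gamma x z y =
  (k z + (r + dot y (A *m x) + gamma / 2 * dot (A *m x) (A *m x)
          - dot (y + gamma *: (A *m x)) z)%:E)%E.
Proof.
move=> fx; rewrite /aug_lagrangian /prox_tilt fx.
have := g_ninfty z; case: (g z) => [s| |] //= _.
rewrite -!EFinD; congr EFin; rewrite !dotE (dotC z); lra.
Qed.

Lemma z_ofE y : z_of A f g gamma y = z_ y.
Proof.
rewrite /z_of x_ofE; have zk : subdiff k (z_ y) (u_ y) := k_grad _.
apply: (@argmin_tilt _ _ k _ gamma _ (u_ y)
  (fine (f (conj_grad f (v_ y))) + dot y (a_ y) + gamma / 2 * dot (a_ y) (a_ y))) => // z.
by rewrite (aug_lagrangianE _ _ (esym (fineK (proj1 (f_grad (v_ y)))))).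
Qed.

Definition dual_value y : R :=
  fine (fenchel f (v_ y)) + fine (fenchel k (u_ y)) - gamma / 2 * dot (a_ y) (a_ y).

Lemma psiE y : psi A f g gamma y = (dual_value y)%:E.
Proof.
rewrite /psi z_ofE x_ofE.
have fx := esym (fineK (proj1 (f_grad (v_ y)))).
rewrite (aug_lagrangianE _ _ fx) /dual_value.
rewrite (fenchel_subdiff (f_grad _)) (fenchel_subdiff (k_grad _)) /=.
rewrite -[k (z_ y)](fineK (proj1 (k_grad (u_ y)))) -EFinD -EFinN; congr EFin.
rewrite -/(a_ y) -/(z_ y) -/(u_ y) /v_ dotNl -mulmx_dot -/(a_ y); lra.
Qed.

Lemma RmapE y : Rmap A f g gamma y = z_ y - a_ y.
Proof. by rewrite /Rmap z_ofE x_ofE. Qed.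

Lemma a_lip : exists C : R, forall y y', `|a_ y' - a_ y| <= C * `|y' - y|.
Proof.
have [C1 C10 AC] := mulmx_norm_le A; have [C2 C20 AtC] := mulmx_norm_le A^T.
exists (C1 * (n%:R / mu * C2)) => y y'.
rewrite /a_ -mulmxBr; apply: (le_trans (AC _)); rewrite -[leRHS]mulrA ler_wpM2l ?(ltW C10) //.
apply: (le_trans (conj_grad_lip f_ninfty mu_gt0 f_sconvex f_grad _ _)).
rewrite -[leRHS]mulrA ler_wpM2l ?divr_ge0 ?(ltW mu_gt0) // /v_ -opprD normrN -mulmxBr.
exact: AtC.
Qed.

Lemma a_continuous : continuous a_.
Proof. by have [C aC] := a_lip; apply: (@lip_continuous _ _ _ _ C) => u w; exact: aC. Qed.

Lemma u_increment y y' : u_ y' - u_ y = (y' - y) + gamma *: (a_ y' - a_ y).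
Proof. by rewrite /u_ scalerBr opprD addrACA. Qed.

Lemma u_lip (L : R) : (forall y y', `|a_ y' - a_ y| <= L * `|y' - y|) ->
  forall y y', `|u_ y' - u_ y| <= (1 + gamma * L) * `|y' - y|.
Proof.
move=> aL y y'; rewrite u_increment mulrDl mul1r.
apply: (le_trans (ler_normD _ _)).
by rewrite lerD2l normrZ gtr0_norm // -mulrA ler_wpM2l // ltW.
Qed.

Lemma z_continuous : continuous z_.
Proof.
move=> y; apply: (@continuous_comp _ _ _ u_ (conj_grad k)).
  have [L aL] := a_lip.
  by apply: (@lip_continuous _ _ _ _ (1 + gamma * L)) => w w'; exact: u_lip.
exact: (conj_grad_continuous k_ninfty gamma_gt0 k_sconvex k_grad).
Qed.

Lemma v_continuous : continuous v_.
Proof.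
have [C _ AtC] := mulmx_norm_le A^T.
apply: (@lip_continuous _ _ _ _ C) => u w.
by rewrite /v_ -opprD normrN -mulmxBr; exact: AtC.
Qed.

Lemma Rmap_continuous : continuous (Rmap A f g gamma).
Proof.
have -> : Rmap A f g gamma = fun y => z_ y - a_ y.
  by apply/funext => y; exact: RmapE.
by move=> y; apply: (@cvgB _ _ _ (nbhs y)); [exact: z_continuous|exact: a_continuous].
Qed.

(** Of the four remainders, [r1], [r2] and [r3] are quadratic because [v_], [u_] and [a_] are
    Lipschitz; [r4] is controlled by the differentiability of [conj_grad f]. *)
Lemma dual_value_frechet y M : M^T = M -> strict_frechet (conj_grad f) (v_ y) M ->
  negligible_at y (fun y' => dual_value y' - dual_value y
    - dot ((1%:M - gamma *: (A *m M *m A^T)) *m (z_ y - a_ y)) (y' - y)).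
Proof.
move=> Msym Mf.
pose r1 y' := fine (fenchel f (v_ y')) - fine (fenchel f (v_ y))
  - dot (conj_grad f (v_ y)) (v_ y' - v_ y).
pose r2 y' := fine (fenchel k (u_ y')) - fine (fenchel k (u_ y))
  - dot (z_ y) (u_ y' - u_ y).
pose r3 y' := - (gamma / 2 * dot (a_ y' - a_ y) (a_ y' - a_ y)).
pose d y' := conj_grad f (v_ y') - conj_grad f (v_ y) - M *m (v_ y' - v_ y).
pose r4 y' := gamma * dot (z_ y - a_ y) (A *m d y').
have vB y' : v_ y' - v_ y = - (A^T *m (y' - y)).
  by rewrite /v_ -opprD -mulmxBr.
have dE y' : A *m d y' = (a_ y' - a_ y) + A *m M *m A^T *m (y' - y).
  by rewrite /d vB mulmxN opprK mulmxDr mulmxBr !mulmxA.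
have [C2 C20 AtC] := mulmx_norm_le A^T.
have [L aL] := a_lip.
have n1 : negligible_at y r1.
  apply: (@negligible_quadratic _ _ _ _ (n%:R * (n%:R / mu) * C2 ^+ 2)) => y'.
  apply: (le_trans (fenchel_taylor f_ninfty mu_gt0 f_sconvex f_grad _ _)).
  rewrite -[leRHS]mulrA; apply: ler_wpM2l; first by rewrite !mulr_ge0 // invr_ge0 ltW.
  rewrite -exprMn.
  by rewrite vB normrN lerXn2r ?nnegrE ?mulr_ge0 // ltW.
have n2 : negligible_at y r2.
  apply: (@negligible_quadratic _ _ _ _ (m%:R * (m%:R / gamma) * (1 + gamma * L) ^+ 2)) => y'.
  apply: (le_trans (fenchel_taylor k_ninfty gamma_gt0 k_sconvex k_grad _ _)).
  rewrite -[leRHS]mulrA; apply: ler_wpM2l; first by rewrite !mulr_ge0 // invr_ge0 ltW.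
  rewrite -exprMn.
  have uL := u_lip aL y y'.
  by rewrite lerXn2r ?nnegrE // (le_trans _ uL).
have n3 : negligible_at y r3.
  apply: (@negligible_quadratic _ _ _ _ (gamma / 2 * (m%:R * L ^+ 2))) => y'.
  rewrite /r3 normrN normrM gtr0_norm ?divr_gt0 // -[leRHS]mulrA.
  rewrite ler_wpM2l ?divr_ge0 ?(ltW gamma_gt0) //.
  apply: (le_trans (dot_norm_le _ _)); rewrite -[leRHS]mulrA ler_wpM2l // -exprMn -expr2.
  by rewrite lerXn2r ?nnegrE // (le_trans _ (aL _ _)).
have nd : negligible_at y (fun y' => `|d y'|).
  (* [v_] stretches increments by at most [C2], which this division absorbs. *)
  move=> e e0; have eC0 : 0 < e / C2 by rewrite divr_gt0.
  have [r r0 Hr] := Mf _ eC0.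
  have nv : \forall y' \near y, ball (v_ y) r (v_ y').
    by apply: v_continuous; exact: nbhsx_ballx.
  apply: filterS nv => y'; rewrite -ball_normE /= => vr.
  rewrite normr_id; apply: (le_trans (Hr _ _ _ _)); first by rewrite subrr normr0.
    by rewrite distrC.
  by rewrite -[leLHS]mulrA ler_wpM2l ?(ltW e0) // ler_pdivrMl // vB normrN AtC.
have n4 : negligible_at y r4.
  have [C1 C10 AC] := mulmx_norm_le A.
  apply: (@negligible_le _ _ _ _ _ (gamma * (m%:R * (`|z_ y - a_ y| * C1))) nd) => y'.
  rewrite normr_id /r4 normrM gtr0_norm // -!mulrA ler_wpM2l ?(ltW gamma_gt0) //.
  by apply: (le_trans (dot_norm_le _ _)); rewrite !ler_wpM2l.
have := negligibleD (negligibleD n1 n2) (negligibleD n3 n4).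
congr negligible_at; apply/funext => y'.
rewrite /r1 /r2 /r3 /r4 dE u_increment vB /dual_value.
have -> : dot ((1%:M - gamma *: (A *m M *m A^T)) *m (z_ y - a_ y)) (y' - y) =
    dot (z_ y - a_ y) (y' - y) -
    gamma * dot (z_ y - a_ y) (A *m M *m A^T *m (y' - y)).
  (* Symmetry of [M] makes [A *m M *m A^T] symmetric, so it moves across the dot product. *)
  rewrite [in RHS]mulmx_dot !trmx_mul trmxK Msym !mulmxA mulmxBl mul1mx.
  by rewrite -scalemxAl !dotE; ring.
have -> : dot (conj_grad f (v_ y)) (- (A^T *m (y' - y))) = - dot (a_ y) (y' - y).
  by rewrite dotNr mulmx_dot trmxK.
exact: dual_increment_identity.
Qed.

Lemma psi_grad y M : M^T = M -> strict_frechet (conj_grad f) (v_ y) M ->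
  ediff (psi A f g gamma) y /\
  grad (psi A f g gamma) y = Qmap A f gamma y *m Rmap A f g gamma y.
Proof.
move=> Msym Mf; have psi_fin : fine \o psi A f g gamma = dual_value.
  by apply/funext => w /=; rewrite psiE.
have [dP gP] := frechet_grad (dual_value_frechet Msym Mf).
have [_ hE] := strict_frechet_hess f_ninfty mu_gt0 f_sconvex f_grad Mf.
rewrite /ediff /grad psi_fin RmapE /Qmap hE; split=> //; split=> //.
by apply: (@filterE _ (nbhs y)) => w; rewrite psiE.
Qed.

End DualFunction.

(** * Transfer to a neighbourhood of the dual solution *)

Theorem theoremV1 (R : realType) (n m : nat) (A : 'M[R]_(m, n))
  (f : 'cV[R]_n -> \bar R) (g : 'cV[R]_m -> \bar R) (mu_f gamma : R)
  (f_proper : proper f) (f_closed : closed_fun f)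
  (mu_f_gt0 : 0 < mu_f) (f_sconvex : strongly_convex mu_f f)
  (g_proper : proper g) (g_closed : closed_fun g) (g_convex : convex_efun g)
  (dom_meet : [set A *m x | x in edom f] `&` edom g !=set0)
  (gamma_gt0 : 0 < gamma)
  (xs : 'cV[R]_n) (ys : 'cV[R]_m)
  (xs_opt : subdiff f xs (- (A^T *m ys)))
  (ys_opt : subdiff g (A *m xs) ys)
  (f_strict : \forall x \near xs,
     edom f x -> strictly_twice_epi_differentiable f x)
  (Sf : {vspace 'cV[R]_n}) (Hf : 'M[R]_n)
  (Hf_sym : Hf^T = Hf) (Hf_psd : forall w : 'cV[R]_n, 0 <= dot (Hf *m w) w)
  (Hf_range : range (fun w : 'cV[R]_n => Hf *m w) = [set` Sf])
  (Hf_ker : [set w : 'cV[R]_n | Hf *m w = 0]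
            = [set w | forall s, s \in Sf -> dot s w = 0])
  (f_epi2 : is_epi_derivative2 f xs (- (A^T *m ys))
     (fun w => (dot (Hf *m w) w)%:E + indic_fun [set` Sf] w)%E) :
  C1_around (psi A f g gamma) ys /\
  (\forall y \near ys,
     twice_ediff (fenchel f) (- (A^T *m y)) /\
     grad (psi A f g gamma) y = Qmap A f gamma y *m Rmap A f g gamma y).
Proof.
have [f_ninfty _] := f_proper; have [g_ninfty _] := g_proper.
have f_grad := conj_gradP f_ninfty f_closed mu_f_gt0 f_sconvex xs_opt.
have k_grad := conj_gradP (prox_tilt_ninfty gamma g_ninfty)
  (prox_tilt_closed (gamma := gamma) g_closed) gamma_gt0
  (prox_tilt_sconvex gamma g_convex) (prox_tilt_subdiff gamma_gt0 ys_opt).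
have G_cont := conj_grad_continuous f_ninfty mu_f_gt0 f_sconvex f_grad.
have strict_v : \forall v \near (- (A^T *m ys)),
    (hess (fenchel f) v)^T = hess (fenchel f) v /\
    strict_frechet (conj_grad f) v (hess (fenchel f) v).
  (* The hypothesis holds near [xs], which is the value of the continuous map [conj_grad f] at
     [- (A^T *m ys)]; it therefore pulls back to a neighbourhood of that point. *)
  have Gxs : conj_grad f (- (A^T *m ys)) = xs.
    exact: subdiff_unique f_ninfty mu_f_gt0 f_sconvex xs_opt (f_grad _).
  have strictG : \forall v \near (- (A^T *m ys)), edom f (conj_grad f v) ->
      strictly_twice_epi_differentiable f (conj_grad f v).
    have nG := f_strict; rewrite -Gxs in nG.
    exact: (@G_cont _ _ nG).
  apply: filterS strictG => v Gv.
  have domG : edom f (conj_grad f v).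
    by rewrite /edom /= -(fineK (proj1 (f_grad v))) ltry.
  have [M Msym Mf] := conj_grad_strict_frechet f_ninfty mu_f_gt0 f_sconvex
    f_grad (Gv domG v (f_grad v)).
  by have [_ ->] := strict_frechet_hess f_ninfty mu_f_gt0 f_sconvex f_grad Mf.
have v_cont := @v_continuous R n m A.
have strict_y : \forall y \near ys,
    [/\ (hess (fenchel f) (- (A^T *m y)))^T = hess (fenchel f) (- (A^T *m y)),
        strict_frechet (conj_grad f) (- (A^T *m y)) (hess (fenchel f) (- (A^T *m y)))
      & {for - (A^T *m y), continuous (hess (fenchel f))}].
  have near_v : \forall v \near (- (A^T *m ys)),
      [/\ (hess (fenchel f) v)^T = hess (fenchel f) v,
        strict_frechet (conj_grad f) v (hess (fenchel f) v)
      & {for v, continuous (hess (fenchel f))}].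
    (* Continuity of the Hessian at [v] needs strict differentiability around [v], hence the
       iterated neighbourhood. *)
    apply: filterS2 strict_v (near_join strict_v) => v [sym_v fr_v] near_v.
    split; [exact: sym_v|exact: fr_v|].
    apply: (@strict_frechet_continuous _ _ _ (conj_grad f)).
    exact: filterS (fun w => @proj2 _ _) near_v.
  exact: (@v_cont _ _ near_v).
have grad_y : \forall y \near ys, ediff (psi A f g gamma) y /\
    grad (psi A f g gamma) y = Qmap A f gamma y *m Rmap A f g gamma y.
  apply: filterS strict_y => y [sym_y fr_y _].
  exact: psi_grad f_ninfty mu_f_gt0 f_sconvex g_ninfty g_convex gamma_gt0
    f_grad k_grad y _ sym_y fr_y.
split; last first.
  apply: filterS2 strict_y grad_y => y [_ fr_y _] [_ gE]; split=> //.
  by have [] := strict_frechet_hess f_ninfty mu_f_gt0 f_sconvex f_grad fr_y.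
apply: filterS3 strict_y grad_y (near_join grad_y) => y [_ _ hess_cont] [psi_diff gE] near_y.
split; first exact: psi_diff.
have R_cont : Rmap A f g gamma w @[w --> nbhs y] --> Rmap A f g gamma y.
  exact: Rmap_continuous f_ninfty mu_f_gt0 f_sconvex g_ninfty g_convex
    gamma_gt0 f_grad k_grad y.
have J_cont : hess (fenchel f) (- (A^T *m w)) @[w --> nbhs y]
    --> hess (fenchel f) (- (A^T *m y)).
  exact: cvg_comp (@v_cont y) hess_cont.
have QR_cont : Qmap A f gamma w *m Rmap A f g gamma w @[w --> nbhs y]
    --> Qmap A f gamma y *m Rmap A f g gamma y.
  (* Expanded into successive matrix-vector products, so that [cvg_mulmx] applies factor by
     factor. *)
  have QRE w : Qmap A f gamma w *m Rmap A f g gamma w = Rmap A f g gamma w -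
      gamma *: (A *m (hess (fenchel f) (- (A^T *m w)) *m (A^T *m Rmap A f g gamma w))).
    by rewrite /Qmap mulmxBl mul1mx -scalemxAl !mulmxA.
  under eq_fun do rewrite QRE.
  rewrite QRE; apply: (@cvgB _ _ _ (nbhs y)) => //.
  apply: (@cvgZr _ _ _ (nbhs y)).
  by do ?[apply: (@cvg_mulmx _ _ _ _ (nbhs y))] => //; exact: cvg_cst.
have grad_cont : grad (psi A f g gamma) w @[w --> nbhs y]
    --> grad (psi A f g gamma) y.
  (* The gradient formula holds on a neighbourhood of [y], so continuity passes from the product to
     [grad]. *)
  rewrite gE; apply: cvg_trans QR_cont; apply: near_eq_cvg.
  by apply: filterS near_y => w [_ ->].
exact: grad_cont.
Qed.
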